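(* For every rational number $p/q$ with $0\le p/q<1$ there exists a crystallographic group $\Gamma$ such that $\mathcal F(\Gamma)=p/q$.
   Context: A crystallographic group is a group acting properly discontinuously and cocompactly by isometries on a Euclidean space $\mathbb R^n$ (i.e. a discrete cocompact subgroup of $\mathrm{Isom}(\mathbb R^n)=\mathbb R^n\rtimes O(n)$). For a finitely generated group $\Gamma$ with finite generating set $S$, let $B_S(r)$ be the ball of radius $r$ about the identity in the word metric, $E_S(r)$ the set of finite-order elements in $B_S(r)$, and $\mathcal F(\Gamma,S)=\lim_{r\to\infty}|E_S(r)|/|B_S(r)|$. For crystallographic groups this limit exists and does not depend on $S$, and it is denoted $\mathcal F(\Gamma)$. *)

(* Defs.v *)
From HB Require Import structures.
From mathcomp Require Import all_boot all_order all_algebra finmap.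
From mathcomp Require Import all_classical all_reals.
From mathcomp Require Import topology normedtype.
Import Order.TTheory GRing.Theory Num.Theory.
Import numFieldNormedType.Exports.

Set Implicit Arguments.
Unset Strict Implicit.
Unset Printing Implicit Defensive.

Local Open Scope classical_set_scope.
Local Open Scope ring_scope.

Section Groups.
Variable G : groupType.
Implicit Types (S H : set G) (r : nat).

Definition is_subgroup H : Prop :=
  [/\ H 1%g, forall x y, H x -> H y -> H (x * y)%g
    & forall x, H x -> H x^-1%g].

Definition word_ball S r : set G :=
  [set g | exists w : seq G, [/\ (size w <= r)%N,
     forall x, x \in w -> S x \/ S x^-1%g & g = (\prod_(x <- w) x)%g]].

(* The union of the word balls of S is the subgroup generated by S. *)
Definition finite_generating_set H S : Prop :=
  finite_set S /\ \bigcup_r word_ball S r = H.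

Definition finite_order : set G :=
  [set g | exists2 k : nat, (0 < k)%N & (g ^+ k)%g = 1%g].

Definition torsion_ball S r : set G := word_ball S r `&` finite_order.

(* [fset_set] sends infinite sets to the empty set, but the balls of a finite
   S are finite. *)
Definition torsion_ratio (R : realType) S r : R :=
  #|` fset_set (torsion_ball S r)|%:R / #|` fset_set (word_ball S r)|%:R.

(* H is finitely generated and F(H) = l; as F(H) stands for the common value of
   F(H, S) over all S, the limit must be l for every finite generating set. *)
Definition torsion_density_eq (R : realType) H (l : R) : Prop :=
  (exists S, finite_generating_set H S) /\
  (forall S, finite_generating_set H S -> torsion_ratio R S r @[r --> \oo] --> l).

End Groups.

Section Isometries.
Variables (R : realType) (n : nat).
Implicit Types x y : 'rV[R]_n.

(* The library's norm on 'rV[R]_n is the sup norm, hence a separate distance;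
   the topology is the same. *)
Definition euclidean_dist x y : R :=
  Num.sqrt (\sum_(i < n) (x 0 i - y 0 i) ^+ 2).

Definition is_isometry (f : 'rV[R]_n -> 'rV[R]_n) : Prop :=
  bijective f /\
  forall x y, euclidean_dist (f x) (f y) = euclidean_dist x y.

Record euclidean_isometry := EuclideanIsometry {
  isometry_fun :> 'rV[R]_n -> 'rV[R]_n;
  isometry_funP : `[< is_isometry isometry_fun >] }.

HB.instance Definition _ := [isSub for isometry_fun].
HB.instance Definition _ := [Choice of euclidean_isometry by <:].

Lemma is_isometry_id : `[< is_isometry id >].
Proof. by apply/asboolP; split=> //; exists id. Qed.

Lemma is_isometry_comp (f g : euclidean_isometry) : `[< is_isometry (f \o g) >].
Proof.
have /asboolP[bf df] := isometry_funP f.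
have /asboolP[bg dg] := isometry_funP g.
apply/asboolP; split=> /=; first exact: bij_comp.
by move=> x y; rewrite df dg.
Qed.

Lemma isometry_inv_subproof (f : euclidean_isometry) :
  {g : euclidean_isometry | cancel f g /\ cancel g f}.
Proof.
apply: cid; have /asboolP[[g fK gK] df] := isometry_funP f.
have ig : `[< is_isometry g >].
  apply/asboolP; split; first by exists f.
  by move=> x y; rewrite -df !gK.
by exists (EuclideanIsometry ig).
Qed.

Definition isometry_one : euclidean_isometry := EuclideanIsometry is_isometry_id.
Definition isometry_mul (f g : euclidean_isometry) : euclidean_isometry :=
  EuclideanIsometry (is_isometry_comp f g).
Definition isometry_inv (f : euclidean_isometry) : euclidean_isometry :=
  sval (isometry_inv_subproof f).

Lemma isometry_mulA : associative isometry_mul.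
Proof. by move=> f g h; apply: val_inj. Qed.
Lemma isometry_mul1g : left_id isometry_one isometry_mul.
Proof. by move=> f; apply: val_inj. Qed.
Lemma isometry_mulg1 : right_id isometry_one isometry_mul.
Proof. by move=> f; apply: val_inj. Qed.
Lemma isometry_mulVg : left_inverse isometry_one isometry_inv isometry_mul.
Proof.
move=> f; apply: val_inj; apply: funext => x /=.
by rewrite /isometry_inv; case: isometry_inv_subproof => g [fK _] /=; exact: fK.
Qed.
Lemma isometry_mulgV : right_inverse isometry_one isometry_inv isometry_mul.
Proof.
move=> f; apply: val_inj; apply: funext => x /=.
by rewrite /isometry_inv; case: isometry_inv_subproof => g [_ gK] /=; exact: gK.
Qed.

HB.instance Definition _ := isGroup.Build euclidean_isometry
  isometry_mulA isometry_mul1g isometry_mulg1 isometry_mulVg isometry_mulgV.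

Definition properly_discontinuous (H : set euclidean_isometry) : Prop :=
  forall K : set 'rV[R]_n, compact K ->
    finite_set [set g | H g /\ (g @` K) `&` K !=set0].

Definition cocompact (H : set euclidean_isometry) : Prop :=
  exists2 K : set 'rV[R]_n, compact K & \bigcup_(g in H) (g @` K) = setT.

Definition crystallographic (H : set euclidean_isometry) : Prop :=
  [/\ is_subgroup H, properly_discontinuous H & cocompact H].

End Isometries.

(* Main.v *)
(* Let P be a product of cyclic groups Z/k, p < k <= q, and T the set of its
   elements with all coordinates nonzero, so that |T| / |P| telescopes to p / q.
   On the space W of the functions on P orthogonal to all vectors fixed by some
   t in T, an element of P has a nonzero fixed vector exactly when it is not in T.
   The projection of Z^P to W is a P-invariant lattice L, and Gamma = L x| P.

   An element of Gamma with point part in T is torsion.  If the point part g is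
   not in T, translations along a fixed vector of g carry the torsion elements
   over g to nontorsion ones, so that these have density 0.  That the cosets of L
   are equidistributed in the balls of every word metric follows from
   |B(r + 1)| / |B(r)| -> 1.  This holds as balls are doubling: pushing the annulus
   between B(r - s) and B(r) towards the origin bounds it by C times the annulus
   between B(r - 4s) and B(r - s); iterate over s = 4^i. *)
From HB Require Import structures.
Require Import Defs.
From mathcomp Require Import all_boot all_order all_algebra finmap.
From mathcomp Require Import all_classical all_reals.
From mathcomp Require Import topology normedtype trigo.
From mathcomp Require Import zify ring lra.
Import Order.TTheory GRing.Theory Num.Theory.
Import numFieldNormedType.Exports.

Set Implicit Arguments.
Unset Strict Implicit.
Unset Printing Implicit Defensive.

Local Open Scope classical_set_scope.

(** * Growth of word balls *)

(** Infinite sets get the value 0, whence the finiteness hypotheses in the lemmas below. *)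
Definition ncard (T : choiceType) (A : set T) : nat := #|` fset_set A|.

Lemma ncard_le (T : choiceType) (A B : set T) :
  finite_set B -> A `<=` B -> (ncard A <= ncard B)%N.
Proof.
move=> fB sAB; apply: fsubset_leq_card; rewrite -fset_set_sub //.
exact: sub_finite_set fB.
Qed.

Lemma ncard_image (T U : choiceType) (f : T -> U) (A : set T) :
  finite_set A -> (ncard (f @` A) <= ncard A)%N.
Proof. by move=> fA; rewrite /ncard fset_set_image // leq_imfset_card. Qed.

Lemma ncard_inj (T U : choiceType) (f : T -> U) (A : set T) (B : set U) :
  finite_set A -> finite_set B ->
  (forall x, A x -> B (f x)) ->
  (forall x y, A x -> A y -> f x = f y -> x = y) -> (ncard A <= ncard B)%N.
Proof.
move=> fA fB fAB fi; rewrite /ncard.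
have <- : #|` (f @` fset_set A)%fset| = #|` fset_set A|.
  rewrite card_in_imfset //= => x y; rewrite !in_fset_set // !inE; exact: fi.
rewrite -fset_set_image //; apply: ncard_le => //.
by move=> _ [x Ax <-]; exact: fAB.
Qed.

Lemma ncardX (T U : choiceType) (A : set T) (B : set U) :
  finite_set A -> finite_set B ->
  ncard (A `*` B) = (ncard A * ncard B)%N.
Proof.
move=> fA fB; rewrite /ncard fset_setX // !card_fset_sum1.
rewrite big_imfset2 /=; last by move=> [? ?] [? ?] _ _ /= [-> ->].
by rewrite big_distrl /=; apply: eq_bigr => i _; rewrite mul1n.
Qed.

Lemma ncard_gt0 (T : choiceType) (A : set T) x :
  finite_set A -> A x -> (0 < ncard A)%N.
Proof.
move=> fA Ax; rewrite cardfs_gt0; apply/fset0Pn; exists x.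
by rewrite in_fset_set // inE.
Qed.

Lemma ncardD (T : choiceType) (A B : set T) : finite_set A -> B `<=` A ->
  ncard (A `\` B) = (ncard A - ncard B)%N.
Proof.
move=> fA sBA; have fB : finite_set B by exact: sub_finite_set fA.
by rewrite /ncard fset_setD // cardfsDS // -fset_set_sub.
Qed.

Lemma ncard_finType (T : finType) : ncard [set: T] = #|T|.
Proof.
rewrite /ncard -(card_finset (@predT T)); congr #|` _|.
apply/fsetP => x; rewrite in_fset_set; last exact: finite_finset.
by rewrite !inE; apply/mem_set.
Qed.

Lemma ncard_fibers (T : choiceType) (I : finType) (f : T -> I) (A : set T) :
  finite_set A ->
  ncard A = (\sum_(i : I) ncard (A `&` [set x | f x = i]))%N.
Proof.
move=> fA; rewrite /ncard card_fset_sum1 (partition_big f predT) //=.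
apply: eq_bigr => i _.
have fAi : finite_set (A `&` [set x | f x = i]).
  by apply: sub_finite_set fA => x [].
rewrite card_fset_sum1 -big_filter; apply: perm_big; apply: uniq_perm.
- exact/filter_uniq/fset_uniq.
- exact: fset_uniq.
- move=> x; rewrite mem_filter (in_fset_set fA) (in_fset_set fAi).
  by apply/andP/idP => [[/eqP fx /set_mem Ax]|/set_mem[Ax /= ->]];
    [apply/mem_set|split=> //; apply/mem_set].
Qed.

(** * Word balls and the annulus inequality *)

Section WordBalls.
Variables (G : groupType) (S : set G).
Local Notation B := (word_ball S).

Lemma word_ball1 r : B r 1%g.
Proof. by exists [::]; split=> //; rewrite big_nil. Qed.

Lemma word_ballM r s x y : B r x -> B s y -> B (r + s) (x * y)%g.
Proof.
move=> [w [sw Sw ->]] [v [sv Sv ->]]; exists (w ++ v); split.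
- by rewrite size_cat leq_add.
- by move=> z; rewrite mem_cat => /orP[/Sw|/Sv].
- by rewrite big_cat.
Qed.

Lemma word_ball_split r s x : B (r + s) x ->
  exists y z, [/\ B r y, B s z & x = (y * z)%g].
Proof.
move=> [w [sw Sw ->]].
exists (\prod_(x <- take r w) x)%g, (\prod_(x <- drop r w) x)%g; split.
- exists (take r w); split=> //; last by move=> z /mem_take /Sw.
  by rewrite size_take_min geq_minl.
- exists (drop r w); split=> //; last by move=> z /mem_drop /Sw.
  by rewrite size_drop leq_subLR.
- by rewrite -big_cat cat_take_drop.
Qed.

Lemma word_ballV r x : B r x -> B r x^-1%g.
Proof.
move=> [w [sw Sw ->]]; exists [seq x^-1%g | x <- rev w]; split.
- by rewrite size_map size_rev.
- by move=> z /mapP[y]; rewrite mem_rev => /Sw[Sy|Sy] ->; rewrite ?invgK;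
  [right|left].
- by rewrite big_map prodgV revK.
Qed.

Lemma word_ball_le r s x : (r <= s)%N -> B r x -> B s x.
Proof. by move=> rs [w [sw Sw ->]]; exists w; split=> //; exact: leq_trans rs. Qed.

Lemma word_ball_letter x : S x \/ S x^-1%g -> B 1 x.
Proof.
move=> Sx; exists [:: x]; split=> //; last by rewrite big_seq1.
by move=> y; rewrite inE => /eqP->.
Qed.

Lemma word_ball_prod r s (w : seq G) : (size w <= s)%N ->
  (forall x, x \in w -> B r x) -> B (r * s) (\prod_(x <- w) x)%g.
Proof.
elim: w s => [|x w IH] [|s] //= sw Bw; try by rewrite big_nil; exact: word_ball1.
rewrite big_cons mulnS; apply: word_ballM; first by apply: Bw; rewrite inE eqxx.
by apply: IH => // y yw; apply: Bw; rewrite inE yw orbT.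
Qed.

Hypothesis finS : finite_set S.

Lemma word_ball_finite r : finite_set (B r).
Proof.
have fS1 : finite_set [set x | S x \/ S x^-1%g].
  apply: (@sub_finite_set _ _ (S `|` (fun x => x^-1%g) @` S)).
    by move=> x [|Sx]; [left|right; exists x^-1%g; rewrite ?invgK].
  by rewrite finite_setU; split=> //; exact: finite_image.
elim: r => [|r IH].
  apply: (@sub_finite_set _ _ [set 1%g]); last exact: finite_set1.
  by move=> x [w []]; rewrite leqn0 size_eq0 => /eqP-> _ ->; rewrite big_nil.
apply: (@sub_finite_set _ _ (1%g |` (fun p : G * G => (p.1 * p.2)%g) @`
    ([set x | S x \/ S x^-1%g] `*` B r))).
  move=> _ [[|x w] [sw Sw ->]]; first by left; rewrite big_nil.
  right; exists (x, \prod_(y <- w) y)%g; last by rewrite big_cons.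
  split=> /=; first by apply: Sw; rewrite inE eqxx.
  by exists w; split=> // y yw; apply: Sw; rewrite inE yw orbT.
rewrite finite_setU; split; first exact: finite_set1.
by apply: finite_image; exact: finite_setX.
Qed.

Local Notation b r := (ncard (B r)).

Lemma growth_gt0 r : (0 < b r)%N.
Proof. by apply: ncard_gt0 (word_ball1 r); exact: word_ball_finite. Qed.

Lemma growth_le r s : (r <= s)%N -> (b r <= b s)%N.
Proof.
move=> rs; apply: ncard_le; first exact: word_ball_finite.
by move=> x; exact: word_ball_le.
Qed.

(* A point x of the outer annulus is at distance at most 2s from some y such
   that y B(s) lies in the inner annulus; count the pairs (x, v) with v in B(s). *)
Lemma annulus_growth r s : (4 * s <= r)%N ->
  ((b r - b (r - s)) * b s <= (b (r - s) - b (r - 4 * s)) * b (3 * s))%N.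
Proof.
move=> sr.
have /choice[y yP] (x : G) : exists y, B r x ->
    B (r - 2 * s) y /\ B (2 * s) (y^-1 * x)%g.
  have [Bx|nBx] := pselect (B r x); last by exists 1%g.
  move: Bx; rewrite -{1}(@subnK (2 * s) r); last by lia.
  move=> /word_ball_split[u [v [Bu Bv ->]]].
  by exists u => _; rewrite mulKg.
have fB := word_ball_finite.
have sB r1 r2 : (r1 <= r2)%N -> B r1 `<=` B r2 by move=> ? ?; exact: word_ball_le.
have fD r1 r2 : finite_set (B r1 `\` B r2) by exact: finite_setD.
rewrite -!ncardD; [|done|apply: sB; lia|done|apply: sB; lia].
rewrite -!ncardX //.
apply: (@ncard_inj _ _
  (fun p : G * G => (y p.1 * p.2, (y p.1 * p.2)^-1 * p.1)%g)).
- exact: finite_setX.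
- exact: finite_setX.
- move=> [x v] [/= [Bx nBx] Bv]; have [By Byx] := yP x Bx.
  split=> /=; last first.
    rewrite invgM -mulgA (_ : 3 * s = s + 2 * s)%N; last by lia.
    by apply: word_ballM => //; exact: word_ballV.
  split.
    rewrite (_ : r - s = r - 2 * s + s)%N; last by lia.
    exact: word_ballM.
  (* If [y x * v] were in B(r - 4s), then x would be reached from it through v^-1 in B(s) and
     [(y x)^-1 * x] in B(2s), hence would lie in B(r - s). *)
  move=> Byv; apply: nBx.
  rewrite -[x](mulVKg (y x)) (_ : r - s = (r - 4 * s + s) + 2 * s)%N; last by lia.
  apply: word_ballM => //; rewrite -[y x](mulgK v).
  by apply: word_ballM => //; exact: word_ballV.
(* The product of the two components is x, so the pair determines x, then v. *)
- move=> [x v] [x' v'] _ _ /= [e1 e2].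
  have e3 : x = x' by move: e2; rewrite e1 => /mulgI.
  by subst x'; move: e1 => /mulgI ->.
Qed.

End WordBalls.

(** * Virtually abelian groups *)

Section AbelianWords.
Variable G : groupType.
Implicit Types (U w v : seq G).

(** A grid of mesh m in the group spanned by U. It is a list with repetitions, so that its size
    depends only on N and the length of U, not on m. *)
Fixpoint power_boxes (m N : nat) U : seq G :=
  if U is x :: U' then
    [seq (x ^+ (m * c) * q)%g | c <- iota 0 N.+1, q <- power_boxes m N U']
  else [:: 1%g].

Lemma size_power_boxes m N U : size (power_boxes m N U) = (N.+1 ^ size U)%N.
Proof.
by elim: U => // x U IH; rewrite size_allpairs size_iota IH expnS.
Qed.

Lemma power_boxes_commute m N U z : (forall x, x \in U -> commute x z) ->
  forall q, q \in power_boxes m N U -> commute q z.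
Proof.
elim: U => [|x U IH] Uz q; first by rewrite inE => /eqP->; apply/commute_sym/commute1.
move=> /allpairsP[[c q'] /= [_ qU ->]]; apply/commute_sym/commuteM.
  by apply/commuteX/commute_sym/Uz; rewrite inE eqxx.
by apply/commute_sym/IH => // y yU; apply: Uz; rewrite inE yU orbT.
Qed.

Lemma prod_commute_split x w : (forall y, y \in w -> commute x y) ->
  (\prod_(y <- w) y = x ^+ count_mem x w * \prod_(y <- w | y != x) y)%g.
Proof.
elim: w => [|y w IH] xw; first by rewrite !big_nil mulg1.
rewrite !big_cons IH; last by move=> z zw; apply: xw; rewrite inE zw orbT.
rewrite /=; case: eqP => [->|/eqP yx] /=; first by rewrite add1n expgS mulgA.
rewrite add0n !mulgA; congr (_ * _)%g.
by apply/commuteX/commute_sym/xw; rewrite inE eqxx.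
Qed.

(* Euclidean division by m of the exponent of each letter. *)
Lemma abelian_word_split m N U w : (0 < m)%N ->
  (forall x y, x \in U -> y \in U -> commute x y) ->
  (forall x, x \in w -> x \in U) -> (size w <= N * m)%N ->
  exists q v, [/\ q \in power_boxes m N U, (size v <= size U * m)%N,
    forall x, x \in v -> x \in U
    & (\prod_(x <- w) x = q * \prod_(x <- v) x)%g].
Proof.
move=> m0; elim: U w => [|x U IH] w cU wU sw.
  exists 1%g, [::]; split=> //; first by rewrite inE.
  have -> : w = [::].
    by case: w wU {sw} => // y w /(_ y); rewrite !inE eqxx => /(_ isT).
  by rewrite big_nil mulg1.
have [|||q [v [qU sv vU e]]] := IH [seq y <- w | y != x].
- by move=> y z yU zU; apply: cU; rewrite inE ?yU ?zU orbT.
- by move=> y; rewrite mem_filter => /andP[/negPf yx /wU]; rewrite inE yx.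
- by rewrite (leq_trans _ sw) // size_filter count_size.
set a := count_mem x w.
have aN : (a <= N * m)%N by rewrite (leq_trans _ sw) // count_size.
exists (x ^+ (m * (a %/ m)) * q)%g, (nseq (a %% m) x ++ v); split.
- apply/allpairsP; exists ((a %/ m)%N, q); split=> //.
  by rewrite mem_iota add0n ltnS -(mulnK N m0) leq_div2r.
- by rewrite size_cat size_nseq mulSn leq_add // ltnW // ltn_mod.
- move=> y; rewrite mem_cat => /orP[|/vU]; rewrite inE; last by move=> ->;
  rewrite orbT.
  by rewrite mem_nseq => /andP[_ ->].
rewrite (prod_commute_split (x := x)); last first.
  by move=> y /wU yU; apply: cU; rewrite ?inE ?eqxx.
rewrite -big_filter e big_cat big_nseq /= -/a.
have -> : iter (a %% m) ( *%g x) 1%g = (x ^+ (a %% m))%g.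
  by elim: (a %% m)%N => //= n ->; rewrite expgS.
have qx : commute q x.
  apply: power_boxes_commute qU => y yU.
  by apply: cU; rewrite inE ?eqxx ?yU ?orbT.
rewrite {1}(divn_eq a m) [(_ %/ _ * _)%N]mulnC expgnDr -!mulgA; congr (_ * _)%g.
by rewrite !mulgA; congr (_ * _)%g; apply/commute_sym/commuteX.
Qed.

End AbelianWords.

(** Bernoulli's inequality (1 + 1/C)^k >= 1 + k/C, cleared of denominators. *)
Lemma bernoulli_nat C k : (C ^ k * (C + k) <= C * C.+1 ^ k)%N.
Proof.
elim: k => [|k IH]; first by rewrite !expn0 mul1n muln1 addn0.
rewrite !expnS; set x := (C ^ k)%N in IH *; set y := (C.+1 ^ k)%N in IH *.
have := leq_mul (leqnn C.+1) IH; nia.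
Qed.

(** * Growth in a group with an abelian normal subgroup of finite index *)

Section VirtuallyAbelian.
Variables (G : groupType) (P : finZmodType) (H : set G) (phi : G -> P).
Hypothesis subH : is_subgroup H.
Hypothesis phiM : forall x y, H x -> H y -> phi (x * y)%g = (phi x + phi y)%R.
Hypothesis phi_onto : forall g, exists2 x, H x & phi x = g.
Hypothesis ker_abelian : forall x y, H x -> H y -> phi x = 0%R -> phi y = 0%R ->
  (x * y = y * x)%g.
Variable S : set G.
Hypothesis genS : finite_generating_set H S.
Local Notation B := (word_ball S).
Local Notation b r := (ncard (B r)).

Let finS : finite_set S. Proof. by case: genS. Qed.
Let H1 : H 1%g. Proof. by case: subH. Qed.
Let HM x y : H x -> H y -> H (x * y)%g. Proof. by case: subH => _ + _; exact. Qed.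
Let HV x : H x -> H x^-1%g. Proof. by case: subH => _ _; exact. Qed.

Lemma word_ball_sub r : B r `<=` H.
Proof. by case: genS => _ <- x Bx; exists r. Qed.

Lemma word_ballP x : H x -> exists r, B r x.
Proof. by case: genS => _ <- [r _ Bx]; exists r. Qed.

Lemma point_map1 : phi 1%g = 0%R.
Proof. by apply: (@addrI _ (phi 1%g)); rewrite -phiM // mulg1 addr0. Qed.

Lemma point_mapV x : H x -> phi x^-1%g = (- phi x)%R.
Proof.
move=> Hx; apply: (@addrI _ (phi x)).
by rewrite -(phiM Hx (HV Hx)) mulgV point_map1 subrr.
Qed.

Lemma common_ball (s : seq G) : (forall x, x \in s -> H x) ->
  exists D, forall x, x \in s -> B D x.
Proof.
elim: s => [|y s IH] Hs; first by exists 0%N.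
have [|D DP] := IH; first by move=> x xs; apply: Hs; rewrite inE xs orbT.
have [r Br] : exists r, B r y by apply/word_ballP/Hs; rewrite inE eqxx.
exists (D + r)%N => x; rewrite inE => /orP[/eqP->|/DP].
  by apply: word_ball_le Br; exact: leq_addl.
by apply: word_ball_le; exact: leq_addr.
Qed.

(* Reidemeister-Schreier: U consists of the elements f g s (f (g + phi s))^-1,
   for a transversal f of the kernel and letters s. *)
Lemma schreier_rewriting : exists (f : P -> G) (U : seq G),
  [/\ forall g, H (f g), forall x, x \in U -> H x /\ phi x = 0%R &
   forall r x, B r x -> exists2 u, (size u <= r)%N /\ (forall y, y \in u -> y \in U)
     & (x = (f 0%R)^-1 * \prod_(y <- u) y * f (phi x))%g].
Proof.
have /choice[f fP] : forall g, exists x, H x /\ phi x = g.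
  by move=> g; have [x] := phi_onto g; exists x.
pose L := [set x | S x \/ S x^-1%g].
have LB : L `<=` B 1 by move=> x; exact: word_ball_letter.
have finL : finite_set L by exact: sub_finite_set (word_ball_finite finS 1).
have HL x : L x -> H x by move=> /LB /word_ball_sub.
pose u g s := (f g * s * (f (g + phi s)%R)^-1)%g.
exists f, [seq u g s | g <- enum P, s <- fset_set L].
split; first by move=> g; case: (fP g).
  move=> x /allpairsP[[g s] /= [_ + ->]]; rewrite in_fset_set // inE => /HL Hs.
  have [Hg eg] := fP g; have [Hgs egs] := fP (g + phi s)%R.
  rewrite /u; split; first by apply: HM; [exact: HM|exact: HV].
  by rewrite (phiM (HM Hg Hs) (HV Hgs)) (phiM Hg Hs) (point_mapV Hgs) eg egs subrr.
move=> r x [w [sw Lw xE]].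
(* By [f g * s = u g s * f (g + phi s)] the representative moves to the right past one letter at a
   time; the induction needs an arbitrary starting class g. *)
have key g : exists2 v, size v = size w /\
    (forall y, y \in v -> y \in [seq u g s | g <- enum P, s <- fset_set L]) &
    (f g * \prod_(y <- w) y = \prod_(y <- v) y * f (g + phi (\prod_(y <- w)
      y)%g)%R)%g.
  elim: w Lw g {sw xE} => [|s w IH] Lw g.
    by exists [::] => //; rewrite !big_nil mulg1 mul1g point_map1 addr0.
  have Ls : L s by apply: Lw; rewrite inE eqxx.
  have [|v [sv vU] e] := IH _ (g + phi s)%R.
    by move=> y yw; apply: Lw; rewrite inE yw orbT.
  exists (u g s :: v).
    split; first by rewrite /= sv.
    move=> y; rewrite inE => /orP[/eqP->|/vU//].
    apply/allpairsP; exists (g, s); split=> //=; first by rewrite mem_enum.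
    by rewrite in_fset_set // inE.
  have Hw : H (\prod_(y <- w) y)%g.
    by apply: (@word_ball_sub (size w)); exists w; split=> // y yw; apply: Lw;
      rewrite inE yw orbT.
  rewrite !big_cons (phiM (HL _ Ls) Hw) addrA -mulgA -e /u -!mulgA.
  by rewrite mulKg.
have [v [sv vU] e] := key 0%R.
exists v; first by rewrite sv.
by move: e; rewrite -xE add0r => e; rewrite -mulgA -e mulKg.
Qed.

(** An element of B(3Em) is rewritten over the kernel generators U, and division of the exponents by
    m leaves a grid point times a remainder in B(Em). Class and grid point take a number of values
    bounded independently of m. *)
Lemma growth_tripling D : exists E C, [/\ (D <= E)%N, (0 < E)%N &
  forall m, (0 < m)%N -> (b (3 * (E * m)) <= C * b (E * m))%N].
Proof.
have [f [U [Hf UK rw]]] := schreier_rewriting.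
have [D0 D0P] := common_ball (fun x xU => (UK x xU).1).
set D1 := maxn (maxn D D0) 1.
have UB x : x \in U -> B D1 x.
  by move=> /D0P; apply: word_ball_le; rewrite /D1; lia.
(* The remainder has at most |U| m letters, each in B(D1), so it fits into B(Em); the successor
   keeps E >= D1 even for empty U. *)
set E := ((size U).+1 * D1)%N.
have DE : (D1 <= E)%N by rewrite /E; nia.
exists E, (#|P| * (3 * E).+1 ^ size U)%N; split; [rewrite /D1 in DE *; lia..|].
move=> m m0.
pose Q := power_boxes m (3 * E) U.
pose h (p : P * ('I_(size Q) * G)) := ((f 0%R)^-1 * nth 1 Q p.2.1 * p.2.2 * f p.1)%g.
have sub : B (3 * (E * m)) `<=` h @` (setT `*` (setT `*` B (E * m))).
  move=> x Bx; have [u [su uU] ->] := rw _ _ Bx.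
  have [|||q [v [qU sv vU ->]]] := @abelian_word_split _ m (3 * E) U u m0.
  - by move=> y z /UK[Hy y0] /UK[Hz z0]; exact: ker_abelian.
  - exact: uU.
  - by rewrite -mulnA.
  exists (phi x, (Ordinal (etrans (index_mem q Q) qU), (\prod_(y <- v) y)%g)).
    split=> //; split=> //=; apply: (@word_ball_le _ _ (D1 * (size U * m))).
      by rewrite /E; nia.
    by apply: word_ball_prod => // y /vU /UB.
  by rewrite /h /= nth_index // !mulgA.
have fB := word_ball_finite finS.
have fQ : finite_set ([set: 'I_(size Q)] `*` B (E * m)).
  by apply: finite_setX => //; exact: finite_finset.
have fT : finite_set ([set: P] `*` ([set: 'I_(size Q)] `*` B (E * m))).
  by apply: finite_setX => //; exact: finite_finset.
apply: (leq_trans (ncard_le _ sub)); first exact: finite_image.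
apply: (leq_trans (ncard_image _ fT)).
rewrite !ncardX //; try exact: finite_finset.
by rewrite !ncard_finType -mulnA card_ord size_power_boxes.
Qed.

(** With s = 4^k E, [annulus_growth] and tripling give b(r) - b(r - s) <= C (b(r - s) - b(r - 4s));
    adding C (b(r) - b(r - s)) to both sides shows that passing from 4s to s shrinks the annulus by
    C / (C + 1). After k = MC rounds Bernoulli makes the total factor at most 1 / (M + 1). *)
Lemma growth_increment D M : exists r0, forall r, (r0 <= r)%N ->
  (M * (b r - b (r - D)) <= b r)%N.
Proof.
have [E [C [DE E0 tri]]] := growth_tripling D.
have step k r : (4 ^ k.+1 * E <= r)%N ->
    (C.+1 * (b r - b (r - 4 ^ k * E)) <= C * (b r - b (r - 4 ^ k.+1 * E)))%N.
  rewrite expnS -mulnA => kr.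
  have := annulus_growth finS kr; rewrite [(4 ^ k * E)%N]mulnC in kr *.
  set s := (E * 4 ^ k)%N in kr *.
  have := tri (4 ^ k)%N; rewrite expn_gt0 /= -/s => /(_ isT) bs.
  have le1 : (b (r - 4 * s) <= b (r - s))%N by apply: growth_le => //; lia.
  have le2 : (b (r - s) <= b r)%N by apply: growth_le => //; lia.
  have b0 := growth_gt0 finS s.
  move=> /leq_trans /(_ (leq_mul (leqnn _) bs)).
  by rewrite mulnA leq_pmul2r //; nia.
have iter k r : (4 ^ k * E <= r)%N ->
    (C.+1 ^ k * (b r - b (r - E)) <= C ^ k * b r)%N.
  suff: (4 ^ k * E <= r -> C.+1 ^ k * (b r - b (r - E)) <=
      C ^ k * (b r - b (r - 4 ^ k * E)))%N.
    by move=> + kr => /(_ kr) /leq_trans; apply; rewrite leq_mul // leq_subr.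
  elim: k => [|k IH] kr; first by rewrite !expn0 !mul1n.
  have kr' : (4 ^ k * E <= r)%N by rewrite (leq_trans _ kr) // expnS; nia.
  have := step _ _ kr; have := IH kr'.
  set X := (b r - b (r - E))%N; set Y := (b r - b (r - 4 ^ k * E))%N.
  set Z := (b r - b (r - 4 ^ k.+1 * E))%N.
  move=> h1 h2; rewrite !expnS -mulnA.
  apply: (leq_trans (leq_mul (leqnn C.+1) h1)).
  by rewrite mulnCA [(C * _)%N]mulnC -mulnA leq_mul.
have C0 : (0 < C)%N.
  by have := tri 1%N isT; case: C {tri step iter} => //;
    rewrite mul0n leqNgt growth_gt0.
exists (4 ^ (M * C) * E)%N => r rr.
apply: (@leq_trans (M * (b r - b (r - E)))).
  by rewrite leq_mul // leq_sub // growth_le //; lia.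
have := iter _ _ rr; have := bernoulli_nat C (M * C).
have : (0 < C ^ (M * C))%N by rewrite expn_gt0 C0.
set x := (C ^ _)%N; set y := (C.+1 ^ _)%N; set X := (_ - _)%N.
move=> x0 h1 h2.
have h3 : (x * (C + M * C) * X <= C * x * b r)%N.
  apply: (leq_trans (leq_mul h1 (leqnn X))).
  by rewrite -!mulnA leq_mul.
have h4 : (x * C * (M * X) <= x * C * b r)%N by nia.
by move: h4; rewrite leq_pmul2l // muln_gt0 x0.
Qed.

Lemma growth_shift D M : exists r0, forall r, (r0 <= r)%N ->
  (M * b (r + D) <= M.+1 * b r)%N.
Proof.
have [r0 r0P] := growth_increment D M.+1; exists r0 => r rr.
have := r0P (r + D)%N; rewrite addnK => /(_ (leq_trans rr (leq_addr _ _))).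
have : (b r <= b (r + D))%N by apply: growth_le => //; exact: leq_addr.
nia.
Qed.

Local Notation coset g := [set x | phi x = g].

Let finB r : finite_set (B r). Proof. exact: word_ball_finite. Qed.
Let finBI r A : finite_set (B r `&` A).
Proof. by apply: sub_finite_set (finB r) => x []. Qed.

(** Right multiplication by a representative of g' - g injects the part of B(r) over g into the part
    of B(r + D) over g', so all cosets have equal shares up to a shift of the radius. *)
Lemma fiber_growth : exists D, forall g r,
  (#|P| * ncard (B r `&` coset g) <= b (r + D))%N /\
  (b r <= #|P| * ncard (B (r + D) `&` coset g))%N.
Proof.
have /choice[f fP] : forall g, exists x, H x /\ phi x = g.
  by move=> g; have [x] := phi_onto g; exists x.
have [D DP] : exists D, forall g, B D (f g).
  have [|D DP] := @common_ball [seq f g | g <- enum P].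
    by move=> _ /mapP[g _ ->]; case: (fP g).
  by exists D => g; apply/DP/map_f; rewrite mem_enum.
have shift g g' r : (ncard (B r `&` coset g) <= ncard (B (r + D) `&` coset g'))%N.
  apply: (@ncard_inj _ _ (fun x => x * f (g' - g)%R)%g) => //.
    move=> x [Bx /= xg]; split; first exact: word_ballM.
    have [Hf ef] := fP (g' - g)%R.
    by rewrite /= (phiM (word_ball_sub Bx) Hf) xg ef addrC subrK.
  by move=> x y _ _ /mulIg.
exists D => g r; split.
  rewrite (ncard_fibers phi (finB (r + D)%N)) -sum_nat_const.
  by apply: leq_sum => g' _; exact: shift.
rewrite (ncard_fibers phi (finB r)) -sum_nat_const.
by apply: leq_sum => g' _; exact: shift.
Qed.

(** * Density of torsion: full over [T], zero over its complement *)

Variable T : {set P}.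
Hypothesis torsT : forall x, H x -> phi x \in T -> finite_order x.
Hypothesis torsTC : forall g, g \notin T -> exists2 u, H u &
  phi u = 0%R /\ forall x, H x -> phi x = g -> finite_order x ->
  forall i, (0 < i)%N -> ~ finite_order (u ^+ i * x)%g.

(* The m translates by 1, u, ..., u^(m-1) of the torsion part of a coset
   outside T are pairwise disjoint. *)
Lemma sparse_torsion : exists D, forall g, g \notin T -> forall m r,
  (m * ncard (torsion_ball S r `&` coset g) <= b (r + m * D))%N.
Proof.
have /choice[D DP] : forall g, exists D, g \notin T -> forall m r,
    (m * ncard (torsion_ball S r `&` coset g) <= b (r + m * D))%N.
  move=> g; have [_|gT] := boolP (g \in T); first by exists 0%N.
  have [u Hu [u0 uP]] := torsTC gT; have [D Du] := word_ballP Hu.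
  exists D => _ m r; set A := torsion_ball S r `&` coset g.
  have fA : finite_set A by apply: sub_finite_set (finB r) => x [[]].
  have AP x : A x -> [/\ H x, phi x = g & finite_order x].
    by move=> [[/word_ball_sub Hx ox] xg].
  have uX i : B (D * i) (u ^+ i)%g.
    elim: i => [|i IH]; first exact: word_ball1.
    by rewrite expgS mulnS; exact: word_ballM.
  (* For i < j the equation reads x = u^(j - i) y, and the right side has infinite order by [uP]. *)
  have inj i j x y : (i <= j)%N -> A x -> A y -> (u ^+ i * x = u ^+ j * y)%g ->
      i = j /\ x = y.
    move=> ij /AP[Hx xg ox] /AP[Hy yg oy]; rewrite -(subnKC ij) expgnDr -mulgA.
    move=> /mulgI xE; have [ji0|ji0] := posnP (j - i)%N.
      by rewrite ji0 addn0; move: xE; rewrite ji0 expg0 mul1g.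
    by case: (uP y Hy yg oy _ ji0); rewrite -xE.
  have -> : (m * ncard A = ncard ([set: 'I_m] `*` A))%N.
    by rewrite ncardX ?ncard_finType ?card_ord //; exact: finite_finset.
  apply: (@ncard_inj _ _ (fun p : 'I_m * G => (u ^+ p.1 * p.2)%g)) => //.
  - by apply: finite_setX => //; exact: finite_finset.
  - move=> [i x] [_ /= [[Bx _] _]]; rewrite addnC; apply: word_ballM => //.
    apply: word_ball_le (uX i); rewrite mulnC leq_mul //; exact: ltnW.
  - move=> [i x] [j y] [_ /= Ax] [_ /= Ay] e.
    have [ij|/ltnW ij] := leqP i j.
      by have [/ord_inj eij exy] := inj _ _ _ _ ij Ax Ay e; rewrite eij exy.
    by have [/ord_inj eij exy] := inj _ _ _ _ ij Ay Ax (esym e); rewrite eij exy.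
exists (\max_g D g)%N => g gT m r; apply: (leq_trans (DP g gT m r)).
apply: growth_le => //; rewrite leq_add2l leq_mul2l; apply/orP; right.
exact: (leq_bigmax g).
Qed.

(** In the error term, |T| pays for the radius shift D of [fiber_growth], and 2|P|^2 for the cosets
    outside T, each with at most b(r + M D') / M <= 2 b(r) / M torsion elements. *)
Lemma torsion_count M : exists r0, forall r, (r0 <= r)%N ->
  (#|P| * (M * ncard (torsion_ball S r)) <=
     (#|T| * M + (#|T| + 2 * #|P| ^ 2)) * b r)%N /\
  (#|T| * M * b r <=
     #|P| * (M * ncard (torsion_ball S r)) + (#|T| + 2 * #|P| ^ 2) * b r)%N.
Proof.
have [D DP] := fiber_growth; have [D' D'P] := sparse_torsion.
have [r1 r1P] := growth_shift D M; have [r2 r2P] := growth_increment D M.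
have [r3 r3P] := growth_shift (M * D') 1.
exists (D + (r1 + (r2 + r3)))%N => r rr.
have {r1P}h1 := r1P r ltac:(lia). have {r2P}h2 := r2P r ltac:(lia).
have {r3P}h3 := r3P r ltac:(lia).
have fT : finite_set (torsion_ball S r) by apply: sub_finite_set (finB r) => x [].
pose t g := ncard (torsion_ball S r `&` coset g).
have tE : (ncard (torsion_ball S r) = \sum_(g in T) t g + \sum_(g in ~: T) t g)%N.
  rewrite (ncard_fibers phi fT) (bigID (mem T)) /=; congr addn.
  by apply: eq_bigl => g; rewrite inE.
have tT g : g \in T -> t g = ncard (B r `&` coset g).
  move=> gT; congr ncard; apply/seteqP; split=> [x [[]]//|x [Bx xg]].
  by split=> //; split=> //; apply: torsT; [exact: word_ball_sub Bx|rewrite xg].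
split.
  have up1 : (#|P| * (\sum_(g in T) t g) <= #|T| * b (r + D))%N.
    rewrite big_distrr -sum_nat_const; apply: leq_sum => g gT.
    by rewrite tT //; case: (DP g r).
  have up2 : (M * (\sum_(g in ~: T) t g) <= #|P| * b (r + M * D'))%N.
    apply: (@leq_trans (\sum_(g in ~: T) b (r + M * D'))).
      by rewrite big_distrr; apply: leq_sum => g; rewrite inE => /D'P; exact.
    by rewrite sum_nat_const leq_mul // max_card.
  rewrite tE; set x := (\sum_(g in T) _)%N in up1 *.
  set y := (\sum_(g in ~: T) _)%N in up2 *.
  have e1 := leq_mul (leqnn M) up1; have e2 := leq_mul (leqnn #|P|) up2.
  have e3 := leq_mul (leqnn #|T|) h1; have e4 := leq_mul (leqnn (#|P| ^ 2)) h3.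
  rewrite expnS expn1 in e4 *; nia.
have lo : (#|T| * b (r - D) <= #|P| * ncard (torsion_ball S r))%N.
  rewrite tE mulnDr; apply: leq_trans (leq_addr _ _).
  rewrite big_distrr -sum_nat_const; apply: leq_sum => g gT.
  have [_] := DP g (r - D)%N; rewrite subnK; last by lia.
  by rewrite tT.
have bD : (b (r - D) <= b r)%N by apply: growth_le => //; lia.
have e1 := leq_mul (leqnn M) lo; have e2 := leq_mul (leqnn #|T|) h2.
rewrite -mulnA -{1}(subnK bD) mulnDr mulnDr.
move: e1 e2; set z := (b r - b (r - D))%N; clear; nia.
Qed.

(** Dividing [torsion_count] by |P| M b(r) bounds the error by K / (|P| M), and M is arbitrary. *)
Lemma torsion_ratio_cvg (R : realType) :
  torsion_ratio R S r @[r --> \oo] --> (#|T|%:R / #|P|%:R : R)%R.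
Proof.
Local Open Scope ring_scope.
pose K := (#|T| + 2 * #|P| ^ 2)%N.
have P0 : 0 < #|P|%:R :> R by rewrite ltr0n; apply/card_gt0P; exists 0.
apply/cvgrPdist_le => e e0.
have [M [M0 eM]] : exists M, (0 < M)%N /\ K%:R <= e * (#|P|%:R * M%:R).
  pose M := (Num.truncn (K%:R / e)).+1.
  have KM : K%:R / e < M%:R by apply: truncnS_gt.
  exists M; split=> //; rewrite mulrC -ler_pdivrMr // (le_trans (ltW KM)) //.
  rewrite ler_peMl ?ler0n // ler1n; move: P0; rewrite ltr0n; lia.
have [r0 r0P] := torsion_count M.
exists r0 => // r /= /r0P[h1 h2]; rewrite /torsion_ratio.
have b0 : 0 < (b r)%:R :> R by rewrite ltr0n growth_gt0.
move: h1 h2; rewrite -/(ncard (torsion_ball S r)) -/(b r) -/K.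
rewrite -!(ler_nat R) !(natrD, natrM) mulrDl.
set t := (ncard _)%:R; set bb : R := (b r)%:R in b0 *.
set p : R := #|P|%:R in P0 eM *; set q : R := #|T|%:R; set m : R := M%:R in eM *.
have m0 : 0 < m by rewrite ltr0n.
set k : R := K%:R in eM *.
move=> h1 h2.
have -> : q / p - t / bb = (q * m * bb - p * (m * t)) / (p * m * bb).
  by field; rewrite !gt_eqF.
rewrite normrM normfV (gtr0_norm (mulr_gt0 (mulr_gt0 P0 m0) b0)).
rewrite ler_pdivrMr ?mulr_gt0 //.
have kE : k = q + 2 * (p * p) by rewrite /k natrD !natrM.
apply: (@le_trans _ _ (k * bb)); first by rewrite ler_norml kE; lra.
by rewrite [leRHS]mulrA; apply: ler_wpM2r => //; exact: ltW.
Qed.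

End VirtuallyAbelian.

(** * Finite abelian groups with prescribed fixed vectors *)

Local Close Scope classical_set_scope.
Local Open Scope ring_scope.

HB.instance Definition _ (P Q : finZmodType) := GRing.Zmodule.on (P * Q)%type.

(** * The cosine on a cyclic group *)

Section CyclicCosine.
Variables (R : realType) (k : nat).

Definition cyclic_cos (x : 'I_k.+1) : R := cos (pi *+ 2 * x%:R / k.+1%:R).

Lemma cos_angle_mod n :
  cos (pi *+ 2 * (n %% k.+1)%:R / k.+1%:R) = cos (pi *+ 2 * n%:R / k.+1%:R) :> R.
Proof.
rewrite -(periodicn (@cosD2pi R) (n %/ k.+1)); congr cos.
rewrite [in RHS](divn_eq n k.+1) natrD natrM -mulr_natr.
by field; rewrite addrC natr1 pnatr_eq0.
Qed.

(** The sum-to-product formula as a recurrence along steps of y, so that it can be summed over an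
    orbit. *)
Lemma cyclic_cosD x y :
  cyclic_cos (x + y + y) + cyclic_cos x = 2 * cyclic_cos y * cyclic_cos (x + y).
Proof.
rewrite /cyclic_cos /= modnDml !cos_angle_mod.
have angleD (m n : nat) : pi *+ 2 * (m + n)%:R / k.+1%:R =
    pi *+ 2 * m%:R / k.+1%:R + pi *+ 2 * n%:R / k.+1%:R :> R.
  by rewrite natrD mulrDr mulrDl.
rewrite !angleD; move: (_ / _) (_ / _) => b a.
by rewrite !(cosD, sinD); ring: (cos2sin2 b).
Qed.

Lemma cyclic_cos0 : cyclic_cos 0 = 1.
Proof. by rewrite /cyclic_cos mulr0 mul0r cos0. Qed.

(** With a = pi x / (k + 1) strictly between 0 and pi, 1 - cos(2a) = 2 sin(a)^2 > 0. *)
Lemma cyclic_cos_eq1 x : x != 0 -> cyclic_cos x != 1.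
Proof.
move=> x0; rewrite /cyclic_cos.
set a : R := pi * (x%:R / k.+1%:R).
have xn : (0 < x)%N by rewrite lt0n.
have k0 : 0 < k.+1%:R :> R by rewrite ltr0n.
have : 0 < sin a.
  apply: sin_gt0_pi; rewrite /a mulr_gt0 ?pi_gt0 ?divr_gt0 ?ltr0n //=.
  by rewrite -[ltRHS]mulr1 ltr_pM2l ?pi_gt0 // ltr_pdivrMr // mul1r ltr_nat.
have -> : pi *+ 2 * x%:R / k.+1%:R = a *+ 2 by rewrite /a; ring.
by rewrite cos_mulr2n cos2sin2; apply: contraTneq; nra.
Qed.

End CyclicCosine.

Section Separating.
Variables (R : realType).

(** Vanishing sums over the cosets of each subgroup generated by some t in T, that is, orthogonality
    to all t-fixed functions. Allowing every m with [t *+ m = 0], not just the order of t, lets the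
    condition pull back along projections of products. *)
Definition trace_free (P : finZmodType) (T : {set P}) (f : P -> R) : Prop :=
  forall t m x, t \in T -> t *+ m = 0 -> \sum_(j < m) f (x + t *+ j) = 0.

(* T is the set of g without nonzero fixed vector in the space W of trace-free
   functions on P, and P acts faithfully on W by translations. *)
Definition separating (P : finZmodType) (T : {set P}) : Prop :=
  (forall g, g \notin T -> exists f : P -> R,
     [/\ trace_free T f, exists x, f x != 0 & forall x, f (x + g) = f x]) /\
  (forall g, g != 0 -> exists2 f : P -> R,
     trace_free T f & exists x, f (x + g) != f x).

Lemma trace_free_fst (P Q : finZmodType) (T : {set P}) (U : {set Q}) f :
  trace_free T f -> trace_free (finset.setX T U) (f \o fst).
Proof.
move=> Tf [t u] m [x y]; rewrite finset.in_setX => /andP[/= tT _].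
have fstM (p : P * Q) n : (p *+ n).1 = p.1 *+ n.
  by elim: n => // n IH; rewrite !mulrS -IH.
move=> /(congr1 fst); rewrite fstM /= => tm0.
by rewrite -[RHS](Tf t m x) //; apply: eq_bigr => j _; rewrite fstM.
Qed.

Lemma trace_free_snd (P Q : finZmodType) (T : {set P}) (U : {set Q}) f :
  trace_free U f -> trace_free (finset.setX T U) (f \o snd).
Proof.
move=> Uf [t u] m [x y]; rewrite finset.in_setX => /andP[_ /= uU].
have sndM (p : P * Q) n : (p *+ n).2 = p.2 *+ n.
  by elim: n => // n IH; rewrite !mulrS -IH.
move=> /(congr1 snd); rewrite sndM /= => um0.
by rewrite -[RHS](Uf u m y) //; apply: eq_bigr => j _; rewrite sndM.
Qed.

(** The sum S over an orbit of t is invariant under t, so the cosine recurrence becomes 2 S = 2 c(t)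
    S, and c(t) is not 1. *)
Lemma cyclic_cos_trace_free k : trace_free (~: [set 0]) (@cyclic_cos R k).
Proof.
move=> t m x; rewrite !inE => t0 tm0.
pose c := @cyclic_cos R k; pose S y := \sum_(j < m) c (y + t *+ j).
have shift y : S (y + t) = S y.
  case: m tm0 @S => [|m] tm0 S; first by rewrite /S !big_ord0.
  rewrite /S big_ord_recr [RHS]big_ord_recl /= addrC mulr0n addr0.
  congr (_ + _); first by rewrite -addrA -mulrS tm0 addr0.
  by apply: eq_bigr => j _; rewrite -addrA -mulrS.
have : S (x + t + t) + S x = 2 * c t * S (x + t).
  rewrite /S -big_split mulr_sumr; apply: eq_bigr => j _ /=.
  by have := cyclic_cosD R (x + t *+ j) t;
    rewrite ![x + _ + t]addrAC [x + t + _ + t]addrAC.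
rewrite !shift => /eqP; rewrite -subr_eq0 => /eqP e.
have : 2 * (1 - c t) * S x = 0 by rewrite -e; ring.
move=> /eqP; rewrite !mulf_eq0 pnatr_eq0 subr_eq0 [1 == _]eq_sym.
by rewrite (negPf (cyclic_cos_eq1 R t0 : c t != 1)) => /eqP.
Qed.

(** A pair outside the product set has g outside T, where a function of the first coordinate serves,
    or h = 0, where the cosine of the second does. The same two kinds of functions detect nonzero
    pairs. *)
Lemma separating_setX (P : finZmodType) (T : {set P}) k : separating T ->
  separating (finset.setX T (~: [set (0 : 'I_k.+1)])).
Proof.
move=> [sepT faithT]; have cosT := @cyclic_cos_trace_free k.
have c0 := @cyclic_cos0 R k; have c1 := @cyclic_cos_eq1 R k.
split=> [[g h]|[g h] gh0].
  rewrite finset.in_setX /= !inE negb_and => /orP[/sepT[f [fT [x fx] fg]]|].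
    exists (f \o fst); split; first exact: trace_free_fst.
      by exists (x, 0).
    by move=> [y z] /=; rewrite fg.
  rewrite negbK => /eqP->; exists (@cyclic_cos R k \o snd); split.
  - exact: trace_free_snd.
  - by exists (0, 0); rewrite /= c0 oner_neq0.
  - by move=> [y z] /=; rewrite addr0.
have [g0|g0] := eqVneq g 0; last first.
  have [f fT [x fx]] := faithT g g0.
  by exists (f \o fst); [exact: trace_free_fst|exists (x, 0)].
exists (@cyclic_cos R k \o snd); first exact: trace_free_snd.
exists (0, 0); rewrite /= add0r c0 c1 //.
by apply: contraNneq gh0 => ->; rewrite g0.
Qed.

Lemma separating_trivial : separating [set: 'I_1].
Proof.
split=> [g|g]; first by rewrite inE.
by rewrite ord1 eqxx.
Qed.

(* The product of the fractions (k - 1) / k for p < k <= p + d. *)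
Lemma separating_ratio p d : exists (P : finZmodType) (T : {set P}),
  separating T /\ (#|T| * (p + d) = #|P| * p)%N.
Proof.
elim: d => [|d [P [T [sT e]]]].
  exists 'I_1, [set: 'I_1]; split; first exact: separating_trivial.
  by rewrite cardsT addn0.
(* For p = 0 the first factor is the trivial group, without nonzero elements, so T becomes empty. *)
exists (P * 'I_(p + d).+1)%type, (finset.setX T (~: [set 0])).
split; first exact: separating_setX.
by rewrite cardsX cardsC1 card_prod card_ord /= addnS e mulnAC.
Qed.

End Separating.

(** * Projectors commuting with translations *)

Lemma row_sqnormE (R : pzRingType) N (v : 'rV[R]_N) :
  (v *m v^T) 0 0 = \sum_j v 0 j ^+ 2.
Proof. by rewrite mxE; apply: eq_bigr => j _; rewrite mxE -expr2. Qed.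

Lemma row_sqnorm_eq0 (R : realDomainType) N (v : 'rV[R]_N) :
  ((v *m v^T) 0 0 == 0) = (v == 0).
Proof.
rewrite row_sqnormE psumr_eq0 => [|j _]; last exact: sqr_ge0.
apply/allP/eqP => [h|-> j _]; last by rewrite mxE expr0n eqxx.
by apply/rowP => j; have := h j (mem_index_enum _);
  rewrite implyTb sqrf_eq0 mxE => /eqP.
Qed.

(** A is an orthogonal projector and the rows of B are an orthonormal basis of its image. Induction
    on the rank: split off a normalized row u of A and continue with A - u^T u. *)
Lemma sym_idem_factor (R : rcfType) N (A : 'M[R]_N) : A^T = A -> A *m A = A ->
  exists n (B : 'M[R]_(n, N)), B *m B^T = 1%:M /\ B^T *m B = A.
Proof.
elim: {A}_.+1 {-2}A (ltnSn (\rank A)) => // r IH A rA symA idA.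
have [->|A0] := eqVneq A 0.
  exists 0, 0; split; last by rewrite mulmx0.
  by apply/matrixP => -[].
have [i v0] : exists i, row i A != 0.
  apply/existsP; apply: contraNT A0; rewrite negb_exists => /forallP Ai.
  by apply/eqP/row_matrixP => i; apply/eqP; rewrite row0 -[_ == _]negbK Ai.
set v := row i A in v0.
have vA : v *m A = v by rewrite /v -row_mul idA.
clearbody v.
pose s := (v *m v^T) 0 0.
have s0 : 0 < s.
  rewrite lt_def row_sqnorm_eq0 v0 /s row_sqnormE.
  by apply: sumr_ge0 => k _; exact: sqr_ge0.
pose u := (Num.sqrt s)^-1 *: v.
have uu : u *m u^T = 1%:M.
  apply/matrixP => a b; rewrite !ord1 /u linearZ /= -scalemxAl -scalemxAr scalerA.
  rewrite mxE -/s !mxE eqxx -invfM -expr2 sqr_sqrtr ?ltW // mulVf ?gt_eqF //.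
have uA : u *m A = u by rewrite /u -scalemxAl vA.
have Au : A *m u^T = u^T by rewrite -{1}symA -trmx_mul uA.
pose A' := A - u^T *m u.
have uA' : u *m A' = 0 by rewrite mulmxBr uA mulmxA uu mul1mx subrr.
have symA' : A'^T = A' by rewrite /A' linearB /= symA trmx_mul trmxK.
have idA' : A' *m A' = A'.
  rewrite {1}/A' mulmxBl -[u^T *m u *m A']mulmxA uA' mulmx0 subr0.
  by rewrite mulmxBr idA mulmxA Au.
have rA' : (\rank A' < r)%N.
  rewrite (leq_trans _ (rA : (\rank A <= r)%N)) //; apply: rank_ltmx.
  have sA : (A' <= A)%MS.
    have -> : A' = A' *m A.
      by rewrite /A' mulmxBl idA -mulmxA uA.
    exact: submxMl.
  (* The rank drops because u lies in the row space of A but is killed by the projector A', which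
     fixes its own row space. *)
  rewrite ltmxE sA /=; apply/negP => AA'.
  have : (u <= A')%MS by rewrite (submx_trans _ AA') // -uA submxMl.
  case/submxP => w uE.
  have u0 : u = 0 by rewrite uE -idA' mulmxA -uE uA'.
  move: uu; rewrite {1}u0 mul0mx => /matrixP /(_ 0 0) /eqP.
  by rewrite !mxE eqxx eq_sym oner_eq0.
have [n [B [BB BA]]] := IH A' rA' symA' idA'.
have uB : u *m B^T = 0.
  apply/eqP; rewrite -row_sqnorm_eq0 trmx_mul trmxK mulmxA -(mulmxA u) BA uA'.
  by rewrite mul0mx mxE.
have Bu : B *m u^T = 0 by rewrite -[B]trmxK -trmx_mul uB trmx0.
exists (1 + n)%N, (col_mx u B); split.
  by rewrite tr_col_mx mul_col_row uu BB Bu uB -scalar_mx_block.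
by rewrite tr_col_mx mul_row_col BA addrC subrK.
Qed.

Section ShiftMatrices.
Variable P : finZmodType.
Local Notation N := #|P|.

(** The regular representation. The ring is a parameter because the same permutation matrices act on
    integer and on real vectors. *)
Definition shift_mx (R : pzSemiRingType) (g : P) : 'M[R]_N :=
  \matrix_(i, j) (enum_val i == enum_val j + g)%:R.

Definition function_row (R : Type) (f : P -> R) : 'rV[R]_N :=
  \row_j f (enum_val j).

Section PzRing.
Variable R : pzSemiRingType.
Local Notation sh := (@shift_mx R).

Lemma mulmx_shift m (A : 'M[R]_(m, N)) g i j :
  (A *m sh g) i j = A i (enum_rank (enum_val j + g)).
Proof.
rewrite mxE (bigD1 (enum_rank (enum_val j + g))) //= mxE enum_rankK eqxx mulr1.
rewrite big1 ?addr0 // => k kj; rewrite mxE; case: eqP => [e|_];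
  last by rewrite mulr0.
by rewrite -e enum_valK eqxx in kj.
Qed.

Lemma function_row_shift f g :
  function_row f *m sh g = function_row (fun x => f (x + g)).
Proof. by apply/rowP => j; rewrite mulmx_shift !mxE enum_rankK. Qed.

Lemma shift_mx0 : sh 0 = 1%:M.
Proof.
by apply/matrixP => i j; rewrite !mxE addr0 (inj_eq enum_val_inj).
Qed.

Lemma shift_mxD g h : sh (g + h) = sh g *m sh h.
Proof.
by apply/matrixP => i j; rewrite mulmx_shift !mxE enum_rankK -addrA (addrC g).
Qed.

Lemma tr_shift_mx g : (sh g)^T = sh (- g).
Proof.
apply/matrixP => i j; rewrite !mxE; congr (_%:R); congr nat_of_bool.
by rewrite [RHS]eq_sym subr_eq.
Qed.

Lemma shift_mxC g h : sh g *m sh h = sh h *m sh g.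
Proof. by rewrite -!shift_mxD addrC. Qed.

End PzRing.

Lemma map_shift_mx (R S : pzRingType) (f : {rmorphism R -> S}) g :
  map_mx f (shift_mx R g) = shift_mx S g.
Proof. by apply/matrixP => i j; rewrite !mxE rmorph_nat. Qed.

(** Translating by g permutes the terms of the sum of all elements of P, yet adds N g to it. *)
Lemma mulrn_card (g : P) : g *+ N = 0.
Proof.
apply: (@addrI _ (\sum_(x : P) x)); rewrite addr0 [RHS](reindex_inj (addIr g)).
by rewrite big_split sumr_const.
Qed.

Variable R : realType.
Local Notation sh := (@shift_mx R).

(** The orthogonal projector onto the t-fixed vectors: N is a multiple of the order of t, so the
    average over N multiples is the average over the subgroup. *)
Definition shift_avg (t : P) : 'M[R]_N :=
  N%:R^-1 *: \sum_(j < N) sh (t *+ j).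

Let N0 : N%:R != 0 :> R.
Proof. by rewrite pnatr_eq0 -lt0n; apply/card_gt0P; exists 0. Qed.

Lemma shift_avg_shift t : shift_avg t *m sh t = shift_avg t.
Proof.
rewrite /shift_avg -scalemxAl mulmx_suml; congr (_ *: _).
suff aux m : t *+ m = 0 ->
    \sum_(j < m) sh (t *+ j) *m sh t = \sum_(j < m) sh (t *+ j).
  exact/aux/mulrn_card.
case: m => [|m] tm; first by rewrite !big_ord0.
rewrite big_ord_recr [RHS]big_ord_recl /= addrC mulr0n -shift_mxD -mulrSr tm.
by congr (_ + _); apply: eq_bigr => j _; rewrite -shift_mxD -mulrSr.
Qed.

Lemma shift_avg_fix m (A : 'M_(m, N)) t : A *m sh t = A -> A *m shift_avg t = A.
Proof.
move=> At; have AX j : A *m sh (t *+ j) = A.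
  elim: j => [|j IH]; first by rewrite mulr0n shift_mx0 mulmx1.
  by rewrite mulrS shift_mxD mulmxA At.
rewrite /shift_avg -scalemxAr mulmx_sumr (eq_bigr (fun=> A)) => [|j _];
  last exact: AX.
by rewrite sumr_const card_ord -[A *+ _]scaler_nat scalerA mulVf // scale1r.
Qed.

Lemma shift_avgC t A : (forall g, A *m sh g = sh g *m A) ->
  A *m shift_avg t = shift_avg t *m A.
Proof.
move=> AC; rewrite /shift_avg -scalemxAl -scalemxAr mulmx_suml mulmx_sumr.
by congr (_ *: _); apply: eq_bigr => j _.
Qed.

Lemma shift_avg_shiftC t g : shift_avg t *m sh g = sh g *m shift_avg t.
Proof. by rewrite shift_avgC // => h; exact: shift_mxC. Qed.

Lemma shift_avg_idem t : shift_avg t *m shift_avg t = shift_avg t.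
Proof. exact/shift_avg_fix/shift_avg_shift. Qed.

(** The average a absorbs every shift by a multiple of t, hence a a^T = a, and the left side is
    symmetric. *)
Lemma tr_shift_avg t : (shift_avg t)^T = shift_avg t.
Proof.
set a := shift_avg t.
have aX j : a *m sh (- (t *+ j)) = a.
  rewrite -{1}[a](_ : a *m sh (t *+ j) = a); last first.
    elim: j => [|j IH]; first by rewrite mulr0n shift_mx0 mulmx1.
    by rewrite mulrS shift_mxD mulmxA shift_avg_shift.
  by rewrite -mulmxA -shift_mxD subrr shift_mx0 mulmx1.
have aa : a *m a^T = a.
  rewrite {2}/a /shift_avg linearZ /= -scalemxAr linear_sum /= mulmx_sumr.
  rewrite (eq_bigr (fun=> a)) => [|j _]; last by rewrite tr_shift_mx aX.
  by rewrite sumr_const card_ord -[a *+ _]scaler_nat scalerA mulVf // scale1r.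
by rewrite -{1}aa trmx_mul trmxK aa.
Qed.

(** A is the product of the commuting projectors 1 - [shift_avg t] for t in s. Each factor has
    denominator N, so a power of N clears the denominators of A. *)
Lemma shift_projector (s : seq P) : exists A : 'M[R]_N,
  [/\ A^T = A /\ A *m A = A, forall g, A *m sh g = sh g *m A,
    exists2 K, (0 < K)%N & exists Z : 'M[int]_N, K%:R *: A = map_mx intr Z,
    forall t, t \in s -> A *m shift_avg t = 0
  & forall v : 'rV_N, (forall t, t \in s -> v *m shift_avg t = 0) -> v *m A = v].
Proof.
elim: s => [|t s [A [[symA idA] AC [K K0 [Z KZ]] As vA]]].
  exists 1%:M; split=> //.
  - by rewrite trmx1 mulmx1.
  - by move=> g; rewrite mulmx1 mul1mx.
  - by exists 1%N => //; exists 1%:M; rewrite scale1r map_mx1.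
  - by move=> v _; rewrite mulmx1.
pose D := 1%:M - shift_avg t.
have AD : A *m D = D *m A.
  by rewrite mulmxBr mulmxBl mulmx1 mul1mx shift_avgC.
have Dg g : D *m sh g = sh g *m D.
  by rewrite mulmxBr mulmxBl mulmx1 mul1mx shift_avg_shiftC.
have symD : D^T = D by rewrite linearB /= trmx1 tr_shift_avg.
have Dt : D *m shift_avg t = 0 by rewrite mulmxBl mul1mx shift_avg_idem subrr.
have idD : D *m D = D by rewrite {2}/D mulmxBr mulmx1 Dt subr0.
exists (A *m D); split.
- split; first by rewrite trmx_mul symA symD AD.
  by rewrite mulmxA -(mulmxA A D A) -AD mulmxA idA -mulmxA idD.
- by move=> g; rewrite -mulmxA Dg !mulmxA AC.
- exists (K * N)%N; first by rewrite muln_gt0 K0 lt0n -(pnatr_eq0 R).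
  exists (Z *m (N%:R%:M - \sum_(j < N) shift_mx int (t *+ j))).
  rewrite map_mxM -KZ map_mxB map_scalar_mx rmorph_nat raddf_sum /=.
  rewrite natrM -scalerA -scalemxAl scalemxAr; congr (_ *: (_ *m _)).
  rewrite /D scalerBr scale_scalar_mx mulr1 /shift_avg scalerA divff // scale1r.
  by congr (_ - _); apply: eq_bigr => j _; rewrite map_shift_mx.
- move=> t'; rewrite inE => /orP[/eqP->|/As At'].
    by rewrite -mulmxA Dt mulmx0.
  by rewrite AD -mulmxA At' mulmx0.
- move=> v vs; rewrite mulmxA vA; last by move=> t' ts; apply: vs;
  rewrite inE ts orbT.
  by rewrite mulmxBr mulmx1 vs ?inE ?eqxx // subr0.
Qed.

Lemma trace_free_avg (T : {set P}) f t : trace_free T f -> t \in T ->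
  function_row f *m shift_avg t = 0.
Proof.
move=> Tf tT; rewrite /shift_avg -scalemxAr mulmx_sumr.
rewrite (eq_bigr (fun j : 'I_N => function_row (fun x => f (x + t *+ j))));
  last first.
  by move=> j _; rewrite function_row_shift.
apply/rowP => k; rewrite mxE summxE [RHS]mxE.
rewrite (eq_bigr (fun j : 'I_N => f (enum_val k + t *+ j))) => [|j _];
  last by rewrite mxE.
by rewrite Tf ?mulrn_card // mulr0.
Qed.

(** The rows of B are an orthonormal basis of W and [B^T *m B] is the projector onto W. A t-fixed
    vector of W equals its own average over t, which is zero on W. *)
Lemma separating_isometry (T : {set P}) :
  exists n (B : 'M[R]_(n, N)),
  [/\ B *m B^T = 1%:M, forall g, B^T *m B *m sh g = sh g *m (B^T *m B),
    exists2 K, (0 < K)%N & exists Z : 'M[int]_N, K%:R *: (B^T *m B) = map_mx intr Z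
    & forall t (v : 'rV_N), t \in T -> v *m sh t = v -> v *m (B^T *m B) = v -> v =
      0] /\
  forall f, trace_free T f -> function_row f *m (B^T *m B) = function_row f.
Proof.
have [A [[symA idA] AC AZ As vA]] := shift_projector (enum T).
have [n [B [BB BA]]] := sym_idem_factor symA idA.
exists n, B; rewrite BA; split; first split=> //.
  move=> t v tT vt vAv; rewrite -(shift_avg_fix vt) -vAv -mulmxA As ?mulmx0 //.
  by rewrite mem_enum.
by move=> f Tf; apply: vA => t; rewrite mem_enum; exact: trace_free_avg.
Qed.

End ShiftMatrices.

(** * The crystallographic group *)

Local Open Scope classical_set_scope.
Local Open Scope ring_scope.

Lemma euclidean_distE (R : realType) n (x y : 'rV[R]_n) :
  euclidean_dist x y = Num.sqrt (((x - y) *m (x - y)^T) 0 0).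
Proof.
by rewrite row_sqnormE; congr Num.sqrt; apply: eq_bigr => i _; rewrite !mxE.
Qed.

Lemma compact_coord_bounded (R : realType) n (K : set 'rV[R]_n) : compact K ->
  exists2 M, 0 <= M & forall x i, K x -> `|x 0 i| <= M.
Proof.
move=> cK.
have /choice[M MP] : forall i : 'I_n, exists M : R, forall x, K x -> `|x 0 i| <= M.
  move=> i; have : compact ((fun x : 'rV[R]_n => x 0 i) @` K).
    apply: continuous_compact => //; apply: continuous_subspaceT => x.
    exact: coord_continuous.
  move=> /compact_bounded[M [_ /(_ (M + 1))]]; rewrite ltrDl ltr01 => /(_ isT) MP.
  by exists (M + 1) => x Kx; apply: MP; exists x.
exists (\sum_i `|M i|); first exact: sumr_ge0.
move=> x i Kx; rewrite (le_trans (MP i x Kx)) // (le_trans (ler_norm _)) //.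
by rewrite (bigD1 i) //= lerDl sumr_ge0.
Qed.

Lemma mulmx_coord_bound (R : realDomainType) m p (v : 'rV[R]_m) (A : 'M[R]_(m, p)) M j :
  0 <= M -> (forall i, `|v 0 i| <= M) ->
  `|(v *m A) 0 j| <= M * \sum_i \sum_k `|A i k|.
Proof.
move=> M0 vM; rewrite mxE mulr_sumr (le_trans (ler_norm_sum _ _ _)) //.
apply: ler_sum => i _; rewrite normrM ler_pM // (bigD1 j) //= lerDl.
exact: sumr_ge0.
Qed.

Lemma absz_shift (L : nat) (w : int) : `|w| <= L%:Z ->
  `|(w + L%:Z)%R|%N%:Z - L%:Z = w /\ (`|(w + L%:Z)%R|%N < L.*2.+1)%N.
Proof. by rewrite ler_norml => /andP[l1 l2]; split; lia. Qed.

Section CrystallographicGroup.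
Variables (R : realType) (P : finZmodType) (n : nat).
Local Notation N := #|P|.
Variable B : 'M[R]_(n, N).
Hypothesis BB : B *m B^T = 1%:M.
Hypothesis BC : forall g, B^T *m B *m shift_mx R g = shift_mx R g *m (B^T *m B).
Local Notation sh := (@shift_mx P R).

(** The action of g on W in the orthonormal basis formed by the rows of B. *)
Definition point_mx (g : P) : 'M[R]_n := B *m sh g *m B^T.

Lemma point_mx0 : point_mx 0 = 1%:M.
Proof. by rewrite /point_mx shift_mx0 mulmx1. Qed.

(** Invariance of W, in the form [BC], makes the projection [B^T] intertwine the regular action with
    that on W. *)
Lemma mul_tr_point_mx g : B^T *m point_mx g = sh g *m B^T.
Proof. by rewrite /point_mx !mulmxA BC -!mulmxA BB mulmx1. Qed.

Lemma mulmx_shift_projected m (A : 'M[R]_(m, N)) g :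
  A *m (B^T *m B) *m sh g = A *m B^T *m point_mx g *m B.
Proof. by rewrite -[LHS]mulmxA BC -(mulmxA A B^T) mul_tr_point_mx !mulmxA. Qed.

Lemma point_mxD g h : point_mx (g + h) = point_mx g *m point_mx h.
Proof.
by rewrite {2}/point_mx -mulmxA mul_tr_point_mx mulmxA -[B *m _ *m _]mulmxA
  -shift_mxD.
Qed.

Lemma tr_point_mx g : (point_mx g)^T = point_mx (- g).
Proof. by rewrite /point_mx !trmx_mul trmxK tr_shift_mx mulmxA. Qed.

Lemma point_mxN g : point_mx g *m point_mx (- g) = 1%:M.
Proof. by rewrite -point_mxD subrr point_mx0. Qed.

Lemma point_mxVN g : point_mx (- g) *m point_mx g = 1%:M.
Proof. by rewrite -point_mxD addNr point_mx0. Qed.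

Lemma motion_subproof g (v : 'rV[R]_n) :
  `[< is_isometry (fun x => x *m point_mx g + v) >].
Proof.
apply/asboolP; split.
  exists (fun x => (x - v) *m point_mx (- g)) => x.
    by rewrite addrK -mulmxA point_mxN mulmx1.
  by rewrite -mulmxA point_mxVN mulmx1 subrK.
move=> x y; rewrite !euclidean_distE opprD addrACA subrr addr0 -mulmxBl.
by rewrite trmx_mul tr_point_mx mulmxA -[_ *m _ *m point_mx (- g)]mulmxA point_mxN
  mulmx1.
Qed.

Definition motion g v : euclidean_isometry R n :=
  EuclideanIsometry (motion_subproof g v).

Lemma motionM g h v w :
  (motion g v * motion h w)%g = motion (g + h) (w *m point_mx g + v).
Proof.
apply: val_inj; apply: funext => x /=.
by rewrite mulmxDl -mulmxA -point_mxD addrA (addrC h).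
Qed.

Lemma motion1 : motion 0 0 = 1%g.
Proof. by apply: val_inj; apply: funext => x /=; rewrite point_mx0 mulmx1 addr0. Qed.

Lemma motionV g v : (motion g v)^-1%g = motion (- g) (- (v *m point_mx (- g))).
Proof.
apply: (mulgI (motion g v)); rewrite mulgV motionM mulNmx -mulmxA.
by rewrite point_mxVN mulmx1 subrr addNr motion1.
Qed.

Definition lattice_vector (z : 'rV[int]_N) : 'rV[R]_n := map_mx intr z *m B^T.

Definition lattice_group : set (euclidean_isometry R n) :=
  [set f | exists g z, f = motion g (lattice_vector z)].

Lemma lattice_vectorD z w :
  lattice_vector (z + w) = lattice_vector z + lattice_vector w.
Proof. by rewrite /lattice_vector map_mxD mulmxDl. Qed.

Lemma lattice_vectorN z : lattice_vector (- z) = - lattice_vector z.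
Proof. by rewrite /lattice_vector map_mxN mulNmx. Qed.

Lemma lattice_vector0 : lattice_vector 0 = 0.
Proof. by rewrite /lattice_vector map_mx0 mul0mx. Qed.

Lemma lattice_vector_point z g :
  lattice_vector z *m point_mx g = lattice_vector (z *m shift_mx int g).
Proof.
by rewrite /lattice_vector map_mxM map_shift_mx -[LHS]mulmxA mul_tr_point_mx mulmxA.
Qed.

Lemma lattice_group_subgroup : is_subgroup lattice_group.
Proof.
split.
- by exists 0, 0; rewrite lattice_vector0 motion1.
- move=> _ _ [g [z ->]] [h [w ->]]; exists (g + h), (w *m shift_mx int g + z).
  by rewrite motionM lattice_vectorD lattice_vector_point.
- move=> _ [g [z ->]]; exists (- g), (- (z *m shift_mx int (- g))).
  by rewrite motionV lattice_vectorN lattice_vector_point.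
Qed.

(** Lift x to y = x B and subtract the integer part: the fractional part has entries in [0, 1), so
    its projection lies in a box of radius N C. *)
Lemma lattice_group_cocompact : cocompact lattice_group.
Proof.
pose C := \sum_i \sum_j `|B i j|.
have CB i j : `|B i j| <= C.
  rewrite /C (bigD1 i) //= (bigD1 j) //= -addrA lerDl addr_ge0 //.
    by apply: sumr_ge0 => k _.
  by apply: sumr_ge0 => k _; apply: sumr_ge0.
exists [set v : 'rV[R]_n | forall i, `[- (N%:R * C), N%:R * C]%classic (v 0 i)].
  apply: (rV_compact (A := fun=> `[- (N%:R * C), N%:R * C]%classic)) => i.
  exact: segment_compact.
rewrite -subTset => x _.
pose y := x *m B; pose z : 'rV[int]_N := \row_j Num.floor (y 0 j).
exists (motion 0 (lattice_vector z)); first by exists 0, z.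
exists ((y - map_mx intr z) *m B^T).
  move=> i /=; rewrite in_itv /= -ler_norml mxE.
  apply: (le_trans (ler_norm_sum _ _ _)).
  apply: (@le_trans _ _ (\sum_(j < N) C));
    last by rewrite sumr_const card_ord mulr_natl.
  apply: ler_sum => j _; rewrite normrM -[leRHS]mul1r ler_pM //; last by rewrite mxE.
  rewrite !mxE; set r := \sum_(k < n) _.
  have /andP[] := mem_rg1_floor r.
  by rewrite ler_norml; lra.
by rewrite /= point_mx0 mulmx1 -mulmxDl subrK -mulmxA BB mulmx1.
Qed.

(* If f = motion g v in the group maps a point of the compact set into it,
   then K v B is an integer vector of bounded size. *)
Lemma lattice_group_discontinuous K (Z : 'M[int]_N) : (0 < K)%N ->
  K%:R *: (B^T *m B) = map_mx intr Z -> properly_discontinuous lattice_group.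
Proof.
move=> K0 KZ C /compact_coord_bounded[M M0 CM].
(* [a] serves all g at once: [M1] bounds the translation v = f(x) - x g, and [M2] the entries of v
   B. *)
pose a := \sum_g \sum_i \sum_k `|point_mx g i k|.
pose M1 := M + M * a.
pose M2 := M1 * \sum_i \sum_k `|B i k|.
have a0 : 0 <= a by do 3 (apply: sumr_ge0 => ? _).
have M10 : 0 <= M1 by rewrite addr_ge0 // mulr_ge0.
pose L := (Num.truncn (K%:R * M2)).+1.
pose y (c : {ffun 'I_N -> 'I_L.*2.+1}) : 'rV[int]_N := \row_j ((c j)%:Z - L%:Z).
(* The finitely many candidates: a point part and an integer vector w = K v B with entries in
   [-L, L], from which v is K^-1 w B^T. *)
pose h (p : P * {ffun 'I_N -> 'I_L.*2.+1}) :=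
  motion p.1 (K%:R^-1 *: (map_mx intr (y p.2) *m B^T)).
apply: (@sub_finite_set _ _ (range h)); last exact/finite_image/finite_finset.
move=> f [[g [z fE]] [_ [[x Cx <-] Cfx]]].
set v := lattice_vector z in fE.
have vM i : `|v 0 i| <= M1.
  have -> : v 0 i = f x 0 i - (x *m point_mx g) 0 i.
    by rewrite fE /= [X in _ = X - _]mxE addrAC subrr add0r.
  rewrite (le_trans (ler_normB _ _)) // lerD ?CM //.
  apply: le_trans (mulmx_coord_bound _ _ M0 _) _; first by move=> k; exact: CM.
  rewrite ler_wpM2l // /a (bigD1 g) //= lerDl.
  by do 3 (apply: sumr_ge0 => ? _).
pose w := z *m Z.
have wE : map_mx intr w = K%:R *: (v *m B).
  by rewrite map_mxM -KZ /v /lattice_vector -scalemxAr mulmxA.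
have wL j : `|w 0 j| <= L%:Z.
  rewrite -(ler_int R) intr_norm.
  have -> : (w 0 j)%:~R = K%:R * (v *m B) 0 j.
    by move/matrixP: wE => /(_ 0 j); rewrite !mxE.
  rewrite normrM normr_nat (le_trans (ler_wpM2l _ (mulmx_coord_bound _ _ M10 vM))) //.
  by apply/ltW/truncnS_gt.
exists (g, [ffun j => inord `|w 0 j + L%:Z|]) => //.
rewrite /h fE /=; congr motion.
have -> : y [ffun j => inord `|w 0 j + L%:Z|] = w.
  by apply/rowP => j; have [e l] := absz_shift (wL j); rewrite mxE ffunE inordK.
rewrite wE -scalemxAl scalerA mulVf ?scale1r; last by rewrite pnatr_eq0 -lt0n.
by rewrite -mulmxA BB mulmx1.
Qed.

(** A motion is a translation times a point element, and translations are integer combinations of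
    the projected basis vectors. *)
Lemma lattice_group_generated : exists S, finite_generating_set lattice_group S.
Proof.
pose S := range (fun g => motion g 0) `|`
  range (fun j => motion 0 (lattice_vector (delta_mx 0 j))).
have [G1 GM GV] := lattice_group_subgroup.
have SG : S `<=` lattice_group.
  move=> _ [[g _ <-]|[j _ <-]]; first by exists g, 0; rewrite lattice_vector0.
  by exists 0, (delta_mx 0 j).
exists S; split; first by rewrite finite_setU; split;
  exact/finite_image/finite_finset.
apply/seteqP; split.
  move=> _ [r _ [w [_ Sw ->]]]; elim: w Sw => [|x w IH] Sw; first by rewrite big_nil.
  rewrite big_cons; apply: GM.
    have [/SG//|/SG/GV] : S x \/ S x^-1%g by apply: Sw; rewrite inE eqxx.
    by rewrite invgK.
  by apply: IH => y yw; apply: Sw; rewrite inE yw orbT.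
pose W := \bigcup_r word_ball S r.
have WM x y : W x -> W y -> W (x * y)%g.
  by move=> [r _ Wx] [s _ Wy]; exists (r + s)%N => //; exact: word_ballM.
have WV x : W x -> W x^-1%g by move=> [r _ Wx]; exists r => //; exact: word_ballV.
have WS x : S x -> W x.
  by move=> Sx; exists 1%N => //; apply: word_ball_letter; left.
pose Q z := W (motion 0 (lattice_vector z)).
have QD z w : Q z -> Q w -> Q (z + w).
  move=> Qz Qw; have := WM _ _ Qz Qw.
  by rewrite motionM addr0 point_mx0 mulmx1 -lattice_vectorD addrC.
have QN z : Q z -> Q (- z).
  by move=> /WV; rewrite motionV oppr0 point_mx0 mulmx1 -lattice_vectorN.
have Q0 : Q 0 by rewrite /Q lattice_vector0; apply: WS; left; exists 0.
have Qn z k : Q z -> Q (z *+ k).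
  by move=> Qz; elim: k => [|k IH]; rewrite ?mulr0n // mulrS; exact: QD.
have QZ z : Q z.
  rewrite [z]row_sum_delta; apply: (big_ind Q) => // j _.
  have Qd : Q (delta_mx 0 j) by apply: WS; right; exists j.
  rewrite -[z 0 j]intz scaler_int; case: (z 0 j) => k; first exact: Qn.
  by rewrite NegzE mulrNz; exact/QN/Qn.
move=> _ [g [z ->]]; rewrite -[g]add0r -[lattice_vector z]add0r.
rewrite -(mul0mx _ (point_mx 0)) -motionM; apply: WM; first exact: QZ.
by apply: WS; left; exists g.
Qed.

(** * Point parts and torsion in the lattice group *)

Section PointMap.
Hypothesis faithful : forall g, g != 0 -> point_mx g != 1%:M.

Lemma motion_inj g h v w : motion g v = motion h w -> g = h /\ v = w.
Proof.
move=> /(congr1 (@isometry_fun R n))/funeqP e.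
have vw : v = w by have := e 0; rewrite /= !mul0mx !add0r.
split=> //; apply/eqP; rewrite -subr_eq0; apply: contraT => /faithful /eqP[].
have e' : point_mx g = point_mx h.
  apply/row_matrixP => i; rewrite !rowE.
  by have := e (delta_mx 0 i); rewrite /= vw => /addIr.
by rewrite point_mxD e' point_mxN.
Qed.

(** By [motion_inj] the choice is unique; 0 is the default for isometries that are not motions. *)
Definition point_part (f : euclidean_isometry R n) : P :=
  xget 0 [set g | exists v, f = motion g v].

Lemma point_part_motion g v : point_part (motion g v) = g.
Proof.
rewrite /point_part; case: xgetP => [h _ [w] /motion_inj[]//|/(_ g)[]].
by exists v.
Qed.

(** The N-th power is a translation commuting with the motion, so its vector is fixed by t and
    vanishes. *)
Lemma motion_torsion t (v : 'rV[R]_n) :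
  (forall w : 'rV_n, w *m point_mx t = w -> w = 0) -> finite_order (motion t v).
Proof.
move=> fixt; exists N; first by rewrite (cardD1 0).
have powE k : exists w, (motion t v ^+ k)%g = motion (t *+ k) w.
  elim: k => [|k [w wE]]; first by exists 0; rewrite motion1.
  by eexists; rewrite expgS wE motionM mulrS.
have := expgS (motion t v) N; rewrite expgSr; have [w ->] := powE N.
rewrite mulrn_card !motionM point_mx0 mulmx1 => /motion_inj[_].
by rewrite addrC => /addIr/esym/fixt->; rewrite motion1.
Qed.

Section FixedVector.
Variables (g : P) (f : 'rV[R]_N).
Hypothesis fg : f *m sh g = f.
Hypothesis fB : f *m (B^T *m B) = f.
Local Notation ip v := ((v *m (f *m B^T)^T) 0 0 : R).

Let ipD (v w : 'rV[R]_n) : ip (v + w) = ip v + ip w.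
Proof. by rewrite mulmxDl mxE. Qed.

(* The component along a fixed vector is additive on the powers of a motion. *)
Lemma torsion_orthogonal v : finite_order (motion g v) -> ip v = 0.
Proof.
have fixg : f *m B^T *m point_mx g = f *m B^T.
  by rewrite -mulmxA mul_tr_point_mx mulmxA fg.
have ipg w : ip (w *m point_mx g) = ip w.
  rewrite -{1}fixg trmx_mul tr_point_mx -mulmxA [point_mx g *m _]mulmxA.
  by rewrite point_mxN mul1mx.
have powE k : exists2 w, (motion g v ^+ k)%g = motion (g *+ k) w & ip w = ip v *+ k.
  elim: k => [|k [w wE ipw]].
    by exists 0; [rewrite motion1|rewrite mul0mx mxE].
  exists (w *m point_mx g + v); first by rewrite expgS wE motionM mulrS.
  by rewrite ipD ipg ipw mulrSr.
move=> [k k0]; have [w -> ipw] := powE k.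
rewrite -motion1 => /motion_inj[_ w0]; move: ipw; rewrite w0 mul0mx mxE.
by move/esym/eqP; rewrite mulrn_eq0 gtn_eqF //= => /eqP.
Qed.

(** Choose j with f_j nonzero and u the translation by the projected j-th basis vector. It has
    component f_j along f, so u^i x has component i f_j, while torsion over g forces component 0. *)
Lemma nontorsion_translation : f != 0 -> exists2 u, lattice_group u &
  point_part u = 0 /\ forall x, lattice_group x -> point_part x = g ->
    finite_order x -> forall i, (0 < i)%N -> ~ finite_order (u ^+ i * x)%g.
Proof.
move=> /rV0Pn[j fj].
set v := lattice_vector (delta_mx 0 j).
have vf : ip v = f 0 j.
  rewrite /v /lattice_vector map_delta_mx -mulmxA trmx_mul trmxK.
  rewrite -rowE mxE.
  have -> : B^T *m (B *m f^T) = f^T.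
    by rewrite mulmxA -{2}fB trmx_mul trmx_mul trmxK.
  by rewrite mxE.
exists (motion 0 v); first by exists 0, (delta_mx 0 j).
split; first exact: point_part_motion.
move=> x [h [z ->]]; rewrite point_part_motion => -> /torsion_orthogonal tz i i0.
have -> : (motion 0 v ^+ i)%g = motion 0 (v *+ i).
  elim: i {i0} => [|i IH]; first by rewrite motion1.
  by rewrite expgS IH motionM point_mx0 mulmx1 addr0 mulrSr.
rewrite motionM add0r point_mx0 mulmx1 => /torsion_orthogonal/eqP.
have ipX : ip (v *+ i) = f 0 j *+ i.
  elim: i {i0} => [|i IH]; first by rewrite mul0mx mxE.
  by rewrite !mulrS ipD IH vf.
by rewrite ipD tz add0r ipX mulrn_eq0 gtn_eqF //= (negPf fj).
Qed.

End FixedVector.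

Lemma lattice_group_density (T : {set P}) :
  (forall t, t \in T -> forall w : 'rV_n, w *m point_mx t = w -> w = 0) ->
  (forall g, g \notin T -> exists f : 'rV[R]_N,
     [/\ f *m sh g = f, f *m (B^T *m B) = f & f != 0]) ->
  torsion_density_eq lattice_group (#|T|%:R / N%:R : R).
Proof.
move=> fixT fixTC; split; first exact: lattice_group_generated.
move=> S genS; apply: (torsion_ratio_cvg (phi := point_part) _ _ _ _ genS).
- exact: lattice_group_subgroup.
- move=> _ _ [g [v ->]] [h [w ->]]; by rewrite motionM !point_part_motion.
- move=> g; exists (motion g (lattice_vector 0)); last exact: point_part_motion.
  by exists g, 0.
- move=> _ _ [g [v ->]] [h [w ->]]; rewrite !point_part_motion => -> ->.
  by rewrite !motionM point_mx0 !mulmx1 [X in motion _ X]addrC.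
- move=> _ [g [v ->]]; rewrite point_part_motion => gT.
  exact/motion_torsion/fixT.
- by move=> g /fixTC[f [fg fB f0]]; exact: nontorsion_translation fg fB f0.
Qed.

End PointMap.
End CrystallographicGroup.

(** * Assembly for a given fraction *)

Theorem theorem1p2 (R : realType) (c : rat) (hc0 : 0 <= c) (hc1 : c < 1) :
  exists (n : nat) (Gamma : set (euclidean_isometry R n)),
    crystallographic Gamma /\ torsion_density_eq Gamma (ratr c : R).
Proof.
pose p := `|numq c|%N; pose q := `|denq c|%N.
have pE : numq c = p%:Z by rewrite /p gez0_abs // numq_ge0.
have qE : denq c = q%:Z by rewrite /q gez0_abs // ltW // denq_gt0.
have q0 : (0 < q)%N by rewrite -ltz_nat -qE denq_gt0.
have pq : (p < q)%N.
  rewrite -ltz_nat -pE -qE -(ltr_int rat) -[ltRHS]mul1r -ltr_pdivrMr ?divq_num_den //.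
  by rewrite ltr0z denq_gt0.
have [P [T [[sepT faithT] TP]]] := separating_ratio R p (q - p).
rewrite subnKC in TP; last exact: ltnW.
have cE : ratr c = #|T|%:R / #|P|%:R :> R.
  have P0 : #|P|%:R != 0 :> R by rewrite pnatr_eq0 (cardD1 0).
  have q0' : q%:R != 0 :> R by rewrite pnatr_eq0 -lt0n.
  by rewrite /ratr pE qE -!pmulrn; apply/eqP; rewrite eqr_div // -!natrM TP mulnC.
have [n [B [[BB BC [K K0 [Z KZ]] fixT] traceB]]] := separating_isometry R T.
exists n, (lattice_group BB BC); split.
  split; first exact: lattice_group_subgroup.
    exact: lattice_group_discontinuous K0 KZ.
  exact: lattice_group_cocompact.
rewrite cE; apply: lattice_group_density.
(* If g acted trivially on W, every trace-free function would be g-invariant, against the one moved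
   by g. *)
- move=> g /faithT[f /traceB fB [x]]; apply: contra_neq => g1.
  have : function_row f *m shift_mx R g = function_row f.
    by rewrite -{1}fB (mulmx_shift_projected BB BC) g1 mulmx1 -mulmxA fB.
  by rewrite function_row_shift => /rowP/(_ (enum_rank x)); rewrite !mxE enum_rankK.
(* A vector w fixed by [point_mx t] lifts to the t-fixed vector w B of W, which is 0; then w = w B
   B^T = 0. *)
- move=> t tT w wt; have wB : w *m B = 0.
    have wBB : w *m B *m (B^T *m B) = w *m B by rewrite mulmxA -(mulmxA w) BB mulmx1.
    apply: (fixT t _ tT) => //.
    by rewrite -{1}wBB (mulmx_shift_projected BB BC) -(mulmxA w) BB mulmx1 wt.
  by rewrite -[w]mulmx1 -BB mulmxA wB mul0mx.
- move=> g /sepT[f [/traceB fB [x fx] fg]]; exists (function_row f); split=> //.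
    by rewrite function_row_shift; apply/rowP => j; rewrite !mxE fg.
  by apply/rV0Pn; exists (enum_rank x); rewrite mxE enum_rankK.
Qed.
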